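(* Let $q\geq 4$ and $m\geq 2$ be integers, and let $\mathfrak{X}=(X,\{R_i\}_{i=0}^4)$ be a symmetric $4$-class association scheme whose first eigenmatrix is \[ P=\begin{bmatrix} 1&\frac12(q-2)q^{2m-1}&\frac12q^{2m}&q(q^{2m-2}-1)&q-2 \\ 1&\frac12(q-2)q^{m-1}&\frac12q^{m}&-(q-1)(q^{m-1}+1)&q-2 \\ 1&-\frac12(q-2)q^{m-1}&-\frac12q^{m}&-(q-1)(q^{m-1}-1)&q-2 \\ 1&\frac12q^m&-\frac12q^m&0&-1 \\ 1&-\frac12q^m&\frac12q^m&0&-1 \end{bmatrix}, \] with adjacency matrices $A_0=I,A_1,A_2,A_3,A_4$. Let $w_0=1$ and let $w_1,w_2,w_3,w_4$ be nonzero complex numbers, put $W=\sum_{j=0}^4 w_jA_j$ and $a_{0,1}=w_0/w_1+w_1/w_0$. Assume $w_4=1$. (i) Assume $w_1=1$. Then $W$ is a complex Hadamard matrix if and only if \[ w_2^2+\frac{2(q^{2m}-2)}{q^{2m}}w_2+1=0 \quad\text{and}\quad w_3=1. \] (ii) Assume \[ a_{0,1}=\frac{2(q^{4m-2}-(q+2)q^{2m-1}+2)}{(q^{2m-1}+q-2)q^{2m-1}}. \] Then $W$ is a complex Hadamard matrix if and only if \[ w_2=-\frac{(q-1)q^{2m-1}w_1+q^{2m-1}+q-2}{(q^{2m-1}-1)q}\quad\text{and}\quad w_3=1. \]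
   Context: A symmetric $d$-class association scheme is a finite set $X$ with a partition $R_0,\dots,R_d$ of $X\times X$ into nonempty symmetric relations, $R_0$ the diagonal, such that the span $\mathcal{A}$ of the adjacency ($0/1$) matrices $A_0,\dots,A_d$ is closed under multiplication (the Bose--Mesner algebra). $\mathcal{A}$ has primitive idempotents $E_0=\frac1{|X|}J,E_1,\dots,E_d$, and the first eigenmatrix $P=(P_{i,j})_{0\le i,j\le d}$ is defined by $A_j=\sum_{i=0}^d P_{i,j}E_i$ (rows indexed by idempotents, columns by relations). Here $|X|=q^{2m}-1$. A complex Hadamard matrix of order $n$ is an $n\times n$ matrix $W$ with all entries of absolute value $1$ and $WW^\ast=nI$, where $\ast$ denotes conjugate transpose.
   Formalization: The entry of P in row E_2, column A_3 should be +(q-1)(q^{m-1}-1): with the printed minus sign that row does not sum to 0, so no scheme has this P. The theorem is proved for the corrected matrix (and holds vacuously for the printed one). *)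

(* Defs.v *)
From HB Require Import structures.
From mathcomp Require Import all_boot all_order all_algebra.
From mathcomp Require Import complex reals.

Set Implicit Arguments.
Unset Strict Implicit.
Unset Printing Implicit Defensive.

Import Order.TTheory GRing.Theory Num.Theory.

Local Open Scope ring_scope.
Local Open Scope complex_scope.

Section AssociationSchemes.
Variables (R : realType) (X : finType).

(* Rows and columns are indexed by X through its canonical enumeration. *)
Definition adjacency (r : {set X * X}) : 'M[R[i]]_#|X| :=
  \matrix_(x, y) ((enum_val x, enum_val y) \in r)%:R.

Definition adjacency_span (d : nat) (r : 'I_d.+1 -> {set X * X}) :
    {vspace 'M[R[i]]_#|X|} :=
  <<[seq adjacency (r i) | i : 'I_d.+1]>>%VS.

Record symmetric_scheme (d : nat) := SymmetricScheme {
  scheme_rel : 'I_d.+1 -> {set X * X};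
  scheme_nonempty : forall i, scheme_rel i != set0;
  scheme_disjoint :
    forall i j, i != j -> [disjoint scheme_rel i & scheme_rel j];
  scheme_cover : \bigcup_i scheme_rel i = [set: X * X];
  scheme_diag : scheme_rel ord0 = [set p | p.1 == p.2];
  scheme_sym :
    forall i x y, (x, y) \in scheme_rel i -> (y, x) \in scheme_rel i;
  scheme_mul_closed : forall M N : 'M[R[i]]_#|X|,
    M \in adjacency_span scheme_rel -> N \in adjacency_span scheme_rel ->
    M *m N \in adjacency_span scheme_rel }.

Variables (d : nat) (S : symmetric_scheme d).

Definition adj_mx (i : 'I_d.+1) : 'M[R[i]]_#|X| := adjacency (scheme_rel S i).

Definition bose_mesner : {vspace 'M[R[i]]_#|X|} :=
  adjacency_span (scheme_rel S).

Definition idempotent_mx (E : 'M[R[i]]_#|X|) : Prop := E *m E = E.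

Definition primitive_idempotent (E : 'M[R[i]]_#|X|) : Prop :=
  [/\ E \in bose_mesner, idempotent_mx E, E != 0 &
      forall F G : 'M[R[i]]_#|X|,
        F \in bose_mesner -> G \in bose_mesner ->
        idempotent_mx F -> idempotent_mx G ->
        F *m G = 0 -> G *m F = 0 -> E = F + G -> F = 0 \/ G = 0].

(* The first eigenmatrix depends on an ordering of the primitive idempotents
   in which J / |X| comes first; P is a first eigenmatrix if it arises from
   some such ordering. *)
Definition first_eigenmatrix (P : 'M[R[i]]_d.+1) : Prop :=
  exists E : 'I_d.+1 -> 'M[R[i]]_#|X|,
    [/\ injective E,
        forall F, primitive_idempotent F <-> exists i, F = E i,
        E ord0 = (#|X|%:R)^-1 *: const_mx 1 &
        forall j, adj_mx j = \sum_i P i j *: E i].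

End AssociationSchemes.

Definition complex_hadamard (R : realType) (n : nat) (W : 'M[R[i]]_n) : Prop :=
  (forall i j, `|W i j| = 1) /\ W *m (map_mx Num.conj W)^T = n%:R%:M.

(* The source prints the entry in row 2, column 3 as -(q-1)(q^(m-1)-1).
   With that sign row 2 sums to -2(q-1)(q^(m-1)-1), which is nonzero for
   m >= 2, while row i of a first eigenmatrix sums to 0 for i <> 0 because
   \sum_j A_j = J = |X| E_0.  So no scheme has the printed matrix; the
   correct entry is +(q-1)(q^(m-1)-1).  [scheme_P true q m] is the matrix as
   printed and [scheme_P false q m] the corrected one. *)
Definition scheme_P (R : realType) (as_printed : bool) (q m : nat) :
    'M[R[i]]_5 :=
  let Q : R[i] := q%:R in
  let e23 := (Q - 1) * (Q ^+ (m - 1) - 1) in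
  let rows : seq (seq R[i]) :=
    [:: [:: 1; 2^-1 * (Q - 2) * Q ^+ (2 * m - 1); 2^-1 * Q ^+ (2 * m);
            Q * (Q ^+ (2 * m - 2) - 1); Q - 2];
        [:: 1; 2^-1 * (Q - 2) * Q ^+ (m - 1); 2^-1 * Q ^+ m;
            - ((Q - 1) * (Q ^+ (m - 1) + 1)); Q - 2];
        [:: 1; - (2^-1 * (Q - 2) * Q ^+ (m - 1)); - (2^-1 * Q ^+ m);
            if as_printed then - e23 else e23; Q - 2];
        [:: 1; 2^-1 * Q ^+ m; - (2^-1 * Q ^+ m); 0; - 1];
        [:: 1; - (2^-1 * Q ^+ m); 2^-1 * Q ^+ m; 0; - 1]] in
  \matrix_(i < 5, j < 5) nth 0 (nth [::] rows i) j.

(* Main.v *)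
Require Import Defs.
From HB Require Import structures.
From mathcomp Require Import all_boot all_order all_algebra.
From mathcomp Require Import complex reals.
From mathcomp Require Import ring lra zify.

(** The Bose-Mesner algebra is commutative (its elements are symmetric), so its
primitive idempotents are orthogonal, and W is Hadamard iff all |w_j| = 1 and
every eigenvalue lambda_i = \sum_j P_ij w_j satisfies |lambda_i|^2 = |X|.

Write s = q^(m-1), t = q^(2m-1), so that |X| = q t - 1, and put
u = ((q - 2) w_1 + q w_2) / 2.  Rows 1 and 2 read |a + b|^2 = |a - b|^2 = |X|
with a = (q - 1)(1 - w_3) and b = s (u - (q - 1) w_3); hence Re (a b^* ) = 0,
which says that Im w_3 and Im u have the same sign.  Row 0 then bounds
t |Im u| + (t - q) |Im w_3| by sqrt (q t - 1).  Rows 3 and 4 fix the angle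
between w_1 and w_2.  In (i), and for one of the two resulting w_2 in (ii), this
gives t Re u = 1 - t and (t Im u)^2 = q t - 1, so w_3 = 1, and conversely all
rows hold; the other w_2 in (ii) makes t |Im u| too large. *)

Set Implicit Arguments.
Unset Strict Implicit.
Unset Printing Implicit Defensive.

Import Order.TTheory GRing.Theory Num.Theory.

Local Open Scope ring_scope.
Local Open Scope complex_scope.

(** * Bose-Mesner algebra: the Hadamard condition in terms of eigenvalues *)

Section BoseMesner.
Variables (R : realType) (X : finType) (d : nat) (S : symmetric_scheme R X d).

Lemma scheme_relP (p : X * X) : exists j, p \in scheme_rel S j.
Proof.
have: p \in \bigcup_i scheme_rel S i by rewrite scheme_cover inE.
by case/bigcupP=> j _; exists j.
Qed.

Lemma adj_combE (v : 'I_d.+1 -> R[i]) j (x y : 'I_#|X|) :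
  (enum_val x, enum_val y) \in scheme_rel S j ->
  (\sum_k v k *: adj_mx S k) x y = v j.
Proof.
move=> xyj; rewrite summxE (bigD1 j) //= !mxE xyj mulr1 big1 ?addr0 // => k kj.
rewrite !mxE (disjointFl (scheme_disjoint S kj)) ?mulr0 //.
Qed.

Lemma adj_comb_norm1 (v : 'I_d.+1 -> R[i]) :
  (forall x y, `|(\sum_k v k *: adj_mx S k) x y| = 1) <->
  (forall j, `|v j| = 1).
Proof.
split=> [h j | h x y].
  have /set0Pn[[a b] abj] := scheme_nonempty S j.
  by rewrite -(h (enum_rank a) (enum_rank b)) (@adj_combE _ j) ?enum_rankK.
have [j xyj] := scheme_relP (enum_val x, enum_val y).
by rewrite (adj_combE _ xyj).
Qed.

Lemma adj_comb_adjoint (v : 'I_d.+1 -> R[i]) :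
  (map_mx Num.conj (\sum_k v k *: adj_mx S k))^T =
  \sum_k (v k)^* *: adj_mx S k.
Proof.
apply/matrixP=> x y; have [j xyj] := scheme_relP (enum_val x, enum_val y).
by rewrite (adj_combE _ xyj) !mxE (@adj_combE _ j) //; apply: scheme_sym.
Qed.

Lemma adj_mx0 : adj_mx S ord0 = 1%:M.
Proof.
by apply/matrixP=> x y; rewrite !mxE scheme_diag inE /= (inj_eq enum_val_inj).
Qed.

Lemma sum_adj_mx : \sum_j adj_mx S j = const_mx 1.
Proof.
rewrite -(eq_bigr _ (fun j _ => scale1r (adj_mx S j))).
apply/matrixP=> x y; have [j xyj] := scheme_relP (enum_val x, enum_val y).
by rewrite (adj_combE _ xyj) mxE.
Qed.

Lemma bose_mesner_tr (M : 'M[R[i]]_#|X|) : M \in bose_mesner S -> M^T = M.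
Proof.
(* [coord_span] expects a tuple, so the generating list is recast as one. *)
rewrite /bose_mesner /adjacency_span -[X in <<X>>%VS]/(tval (in_tuple _)).
move/coord_span=> {1 2}->; rewrite linear_sum; apply: eq_bigr => i _ /=.
rewrite linearZ /=; congr (_ *: _).
have /mapP[j _ ->] := mem_nth 0 (ltn_ord i).
apply/matrixP=> x y; rewrite !mxE; congr (_%:R); congr nat_of_bool.
by apply/idP/idP; apply: scheme_sym.
Qed.

Lemma bose_mesnerC (M N : 'M[R[i]]_#|X|) :
  M \in bose_mesner S -> N \in bose_mesner S -> M *m N = N *m M.
Proof.
move=> hM hN; rewrite -(bose_mesner_tr (scheme_mul_closed hM hN)) trmx_mul.
by rewrite !bose_mesner_tr.
Qed.

(* E F is an idempotent below both E and F, so primitivity makes it 0 or equal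
   to both. *)
Lemma primitive_idempotent_orthogonal (E F : 'M[R[i]]_#|X|) :
  primitive_idempotent S E -> primitive_idempotent S F -> E <> F ->
  E *m F = 0.
Proof.
have absorb A B : primitive_idempotent S A -> primitive_idempotent S B ->
    A *m B = 0 \/ A *m B = A.
  move=> [hA iA _ pA] [hB iB _ _].
  have AB := bose_mesnerC hA hB.
  have iAB : (A *m B) *m (A *m B) = A *m B.
    by rewrite {1}AB mulmxA -(mulmxA B) iA -AB -mulmxA iB.
  have AAB : A *m (A *m B) = A *m B by rewrite mulmxA iA.
  have ABA : (A *m B) *m A = A *m B by rewrite AB -mulmxA iA.
  have hAB : A *m B \in bose_mesner S by apply: scheme_mul_closed.
  (* A = AB + (A - AB) splits A into orthogonal idempotents of the algebra, so one summand
     vanishes. *)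
  case: (pA (A *m B) (A - A *m B)).
  - by [].
  - by rewrite memvB.
  - exact: iAB.
  - by rewrite /idempotent_mx mulmxBl !mulmxBr iA AAB ABA iAB subrr subr0.
  - by rewrite mulmxBr ABA iAB subrr.
  - by rewrite mulmxBl AAB iAB subrr.
  - by rewrite addrC subrK.
  - by left.
  - by move/eqP; rewrite subr_eq0 => /eqP/esym; right.
move=> hE hF neEF; case: (absorb E F hE hF) => // EF_E.
case: (absorb F E hF hE) => [FE|FE]; case: hE => hE _ _ _; case: hF => hF _ _ _.
  by rewrite bose_mesnerC.
by case: neEF; rewrite -EF_E bose_mesnerC.
Qed.

Lemma primitive_comb_mul (E : 'I_d.+1 -> 'M[R[i]]_#|X|) (a : 'I_d.+1 -> R[i]) i :
  injective E -> (forall k, primitive_idempotent S (E k)) ->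
  (\sum_k a k *: E k) *m E i = a i *: E i.
Proof.
move=> injE pE; have [_ iE _ _] := pE i.
rewrite mulmx_suml (bigD1 i) //= -scalemxAl iE big1 ?addr0 // => k ki.
rewrite -scalemxAl primitive_idempotent_orthogonal ?scaler0 // => /injE/eqP.
exact/negP.
Qed.

Variable P : 'M[R[i]]_d.+1.
Hypothesis hP : first_eigenmatrix S P.

Let n : R[i] := #|X|%:R.

Lemma card_scheme_neq0 : n != 0.
Proof.
have /set0Pn[[a _] _] := scheme_nonempty S ord0.
by rewrite pnatr_eq0 -lt0n; apply/card_gt0P; exists a.
Qed.

(** Multiply sum_j A_j = J = n E_0 by E_i and compare coefficients. Row 0 yields |X|; row 2 excludes
    the printed matrix. *)
Lemma first_eigenmatrix_row_sum i : \sum_j P i j = if i == ord0 then n else 0.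
Proof.
have [E [injE primE E0 adjE]] := hP.
have pE k : primitive_idempotent S (E k) by apply/primE; exists k.
have [_ _ nzE _] := pE i.
have JE : const_mx 1 = \sum_k (if k == ord0 then n else 0) *: E k.
  rewrite (bigD1 ord0) //= big1 => [|k /negPf->]; last by rewrite scale0r.
  by rewrite addr0 E0 scalerA mulfV ?scale1r // card_scheme_neq0.
have : (const_mx 1 : 'M[R[i]]_#|X|) *m E i = (\sum_j P i j) *: E i.
  rewrite -sum_adj_mx mulmx_suml scaler_suml; apply: eq_bigr => j _.
  by rewrite adjE primitive_comb_mul.
rewrite JE primitive_comb_mul // => /esym/eqP.
by rewrite -subr_eq0 -scalerBl scaler_eq0 (negPf nzE) orbF subr_eq0 => /eqP.
Qed.

(** Since the A_j are real and symmetric, the adjoint only conjugates the weights; W and its adjoint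
    are then both diagonal in the E_i. As P is not assumed real here, the second factor is not
    written as the conjugate of the first. *)
Lemma complex_hadamard_eigen (v : 'I_d.+1 -> R[i]) :
  complex_hadamard (\sum_j v j *: adj_mx S j) <->
  (forall j, `|v j| = 1) /\
  (forall i, (\sum_j P i j * v j) * (\sum_j P i j * (v j)^*) = n).
Proof.
rewrite /complex_hadamard adj_comb_adjoint adj_comb_norm1.
have [E [injE primE E0 adjE]] := hP.
have pE k : primitive_idempotent S (E k) by apply/primE; exists k.
have nzE k : E k != 0 by case: (pE k).
have combE a i := primitive_comb_mul a i injE pE.
have adj_combD a :
    \sum_j a j *: adj_mx S j = \sum_i (\sum_j P i j * a j) *: E i.
  under eq_bigr => j _ do rewrite adjE scaler_sumr.
  rewrite exchange_big; apply: eq_bigr => i _; rewrite scaler_suml.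
  by apply: eq_bigr => j _; rewrite scalerA mulrC.
(* Expanding I = A_0 in the E_i and multiplying by E_i forces coefficient 1. *)
have EI : 1%:M = \sum_i E i.
  have e : 1%:M = \sum_i P i ord0 *: E i by rewrite -adj_mx0 adjE.
  rewrite {1}e; apply: eq_bigr => i _.
  by rewrite -[RHS]mul1mx e combE.
rewrite !adj_combD.
have prodE a b : (\sum_k a k *: E k) *m (\sum_k b k *: E k) =
    \sum_k (a k * b k) *: E k.
  rewrite mulmx_sumr; apply: eq_bigr => k _.
  by rewrite -scalemxAr combE scalerA mulrC.
rewrite prodE; split=> -[h1 h2]; split=> //.
  move=> i.
  have := congr1 (mulmx^~ (E i)) h2.
  rewrite combE mul_scalar_mx => /eqP.
  by rewrite -subr_eq0 -scalerBl scaler_eq0 (negPf (nzE i)) orbF subr_eq0 => /eqP.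
rewrite -scalemx1 EI scaler_sumr; apply: eq_bigr => i _; by rewrite h2.
Qed.

End BoseMesner.

(** * The eigenvalue equations over the reals *)

Section RealSystem.
Variable R : realType.
Implicit Types q s t x y u v : R.

(* Real form of |lambda_i|^2 = q t - 1 for the eigenvalues lambda_i of W, with
   s = q^(m-1), t = q^(2m-1), w_3 = x3 + i y3 and
   u + i v = ((q - 2) w_1 + q w_2) / 2. *)
Definition row0_eq q t u v x3 y3 :=
  (q - 1 + t * u + (t - q) * x3) ^+ 2 + (t * v + (t - q) * y3) ^+ 2 = q * t - 1.

Definition row12_eq q s t u v x3 y3 :=
  ((q - 1) * (1 - x3) + s * (u - (q - 1) * x3)) ^+ 2 +
  (- (q - 1) * y3 + s * (v - (q - 1) * y3)) ^+ 2 = q * t - 1.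

Definition row34_eq q t x1 y1 x2 y2 :=
  4^-1 * q * t * ((x1 - x2) ^+ 2 + (y1 - y2) ^+ 2) = q * t - 1.

(** Subtracting the two rows leaves 4 Re (a conj b) = 0. With |w_3| = 1 the terms quadratic in w_3
    become constant, and 1 - x3 factors out. *)
Lemma rows12_orthogonal q s t u v x3 y3 : 1 < q -> 0 < s ->
  x3 ^+ 2 + y3 ^+ 2 = 1 ->
  row12_eq q s t u v x3 y3 -> row12_eq q (- s) t u v x3 y3 ->
  (1 - x3) * (u + q - 1) = y3 * v.
Proof.
rewrite /row12_eq => q1 s0 h3 h1 h2.
have : 4 * (q - 1) * s * ((1 - x3) * (u + q - 1) - y3 * v) = 0.
  have -> : 4 * (q - 1) * s * ((1 - x3) * (u + q - 1) - y3 * v) =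
    (q * t - 1) - (q * t - 1) - 4 * (q - 1) ^+ 2 * s * (x3 ^+ 2 + y3 ^+ 2 - 1).
    by rewrite -{1}h1 -h2; ring.
  by rewrite h3; ring.
move/eqP; rewrite !mulf_eq0 subr_eq0 => /orP[|/eqP]; last first.
  by move/eqP; rewrite subr_eq0 => /eqP.
by rewrite pnatr_eq0 /= (gt_eqF q1) (gt_eqF s0).
Qed.

(* Rows 1 and 2 force y3 and v to have the same sign, so row 0 cannot
   accommodate a nonzero y3 once t |v| is already at least sqrt (q t - 1). *)
Lemma rows012_rigid q s t u v x3 y3 : 1 < q -> 0 < s -> q < t ->
  x3 ^+ 2 + y3 ^+ 2 = 1 -> 1 - q < u -> q * t - 1 <= (t * v) ^+ 2 ->
  row0_eq q t u v x3 y3 ->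
  row12_eq q s t u v x3 y3 -> row12_eq q (- s) t u v x3 y3 ->
  [/\ x3 = 1, y3 = 0 & (t * v) ^+ 2 = q * t - 1].
Proof.
move=> q1 s0 qt h3 hu hv h0 h1 h2.
have orth := rows12_orthogonal q1 s0 h3 h1 h2.
have x1 : 0 <= 1 - x3 by clear -h3; have := sqr_ge0 y3; nra.
have yv : 0 <= y3 * v by rewrite -orth; apply: mulr_ge0 => //; lra.
have tq : 0 < t - q by lra.
have t0 : 0 < t by lra.
have cross : 0 <= t * (t - q) * (y3 * v).
  by apply: mulr_ge0 => //; apply: mulr_ge0; apply: ltW.
have Imb : (t * v) ^+ 2 + ((t - q) * y3) ^+ 2 <= q * t - 1.
  rewrite -h0; have := sqr_ge0 (q - 1 + t * u + (t - q) * x3).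
  set a := _ ^+ 2; set b := t * v; set c := (t - q) * y3 => a0.
  have : 0 <= b * c.
    by rewrite /b /c [X in 0 <= X](_ : _ = t * (t - q) * (y3 * v)); last ring.
  rewrite sqrrD; lra.
have sq0 := sqr_ge0 ((t - q) * y3).
have /eqP : ((t - q) * y3) ^+ 2 = 0 by lra.
rewrite sqrf_eq0 mulf_eq0 (gt_eqF tq) /= => /eqP y0.
split=> //; last by lra.
(* Now (1 - x3)(u + q - 1) = 0, and u > 1 - q excludes the second factor, hence x3 = -1. *)
move: orth; rewrite y0 mul0r => /eqP; rewrite mulf_eq0 => /orP[|/eqP]; last by lra.
by rewrite subr_eq0 => /eqP.
Qed.

(** At w_3 = 1 the term a vanishes, so rows 1 and 2 coincide ([key]), and the real part in row 0 is
    t u + t - 1 = 0. *)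
Lemma rows_solution q s t u v : 0 < t -> q * s ^+ 2 = t ->
  t * u = 1 - t -> (t * v) ^+ 2 = q * t - 1 ->
  [/\ row0_eq q t u v 1 0, row12_eq q s t u v 1 0 & row12_eq q (- s) t u v 1 0].
Proof.
move=> t0 ts hu hv; rewrite /row0_eq /row12_eq.
have key : s ^+ 2 * ((u - (q - 1)) ^+ 2 + v ^+ 2) = q * t - 1.
  apply: (mulfI (lt0r_neq0 (exprn_gt0 2 t0))).
  have -> : t ^+ 2 * (s ^+ 2 * ((u - (q - 1)) ^+ 2 + v ^+ 2)) =
     s ^+ 2 * ((t * u - (q - 1) * t) ^+ 2 + (t * v) ^+ 2) by ring.
  by rewrite hu hv -ts; ring.
split; try by rewrite -[RHS]key; ring.
rewrite [X in X ^+ 2 + _](_ : _ = 0); first by rewrite mulr0 addr0 hv expr0n add0r.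
by rewrite hu; ring.
Qed.

(** The discriminant is negative, so the roots are conjugate with product 1 and sum a. This serves
    for w_2 in (i) and for w_1 in (ii). *)
Lemma reciprocal_rootP (w : R[i]) (a : R) : a ^+ 2 < 4 ->
  w ^+ 2 - a%:C * w + 1 = 0 <->
  2 * complex.Re w = a /\ complex.Re w ^+ 2 + complex.Im w ^+ 2 = 1.
Proof.
case: w => x y a4 /=; rewrite expr2; simpc; split=> [[hx hy] | [ax h]]; last first.
  by apply/eqP; rewrite eq_complex /= -ax; apply/andP; split; apply/eqP; lra.
have /eqP : y * (2 * x - a) = 0 by rewrite -[RHS]hy; ring.
rewrite mulf_eq0 => /orP[/eqP y0 | /eqP xa].
  (* A real root would give (2 x - a)^2 = a^2 - 4 < 0. *)
  by exfalso; rewrite y0 in hx; have := sqr_ge0 (2 * x - a); nra.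
split; first by lra.
have {xa} : a = 2 * x by lra.
by move=> ax; rewrite ax in hx; lra.
Qed.

Lemma normc_eq1P (w : R[i]) :
  `|w| = 1 <-> complex.Re w ^+ 2 + complex.Im w ^+ 2 = 1.
Proof.
split=> [w1 | h].
  by apply: (@complexI R); rewrite add_Re2_Im2 w1 expr1n.
by apply/eqP; rewrite -(@pexpr_eq1 _ _ 2) // -add_Re2_Im2 h.
Qed.

(** Four equations suffice for five rows: row 2 is row 1 with s negated, and the eigenvalues of rows
    3 and 4 are opposite. *)
Definition rows_eq q s t x1 y1 x2 y2 x3 y3 :=
  let u := 2^-1 * ((q - 2) * x1 + q * x2) in
  let v := 2^-1 * ((q - 2) * y1 + q * y2) in
  [/\ row0_eq q t u v x3 y3, row12_eq q s t u v x3 y3,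
      row12_eq q (- s) t u v x3 y3 & row34_eq q t x1 y1 x2 y2].

Lemma row34_eq_inner q t x1 y1 x2 y2 :
  x1 ^+ 2 + y1 ^+ 2 = 1 -> x2 ^+ 2 + y2 ^+ 2 = 1 ->
  row34_eq q t x1 y1 x2 y2 <-> q * t * (x1 * x2 + y1 * y2) = 2 - q * t.
Proof.
rewrite /row34_eq => h1 h2.
have -> : (x1 - x2) ^+ 2 + (y1 - y2) ^+ 2 = (x1 ^+ 2 + y1 ^+ 2) +
    (x2 ^+ 2 + y2 ^+ 2) - 2 * (x1 * x2 + y1 * y2) by ring.
by rewrite h1 h2; split=> h; lra.
Qed.

(** Row 3 prescribes x2, which makes (t v)^2 exactly q t - 1: the boundary case of
    [rows012_rigid]. *)
Lemma rows_eq_w1_eq1 q s t x2 y2 x3 y3 :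
  4 <= q -> 0 < s -> q * s ^+ 2 = t -> 2 * q <= t ->
  x2 ^+ 2 + y2 ^+ 2 = 1 ->
  x3 ^+ 2 + y3 ^+ 2 = 1 ->
  rows_eq q s t 1 0 x2 y2 x3 y3 <->
  [/\ q * t * x2 = 2 - q * t, x3 = 1 & y3 = 0].
Proof.
move=> q4 s0 ts qt; have t0 : 0 < t by lra.
move=> h2 h3; have h1 : 1 ^+ 2 + 0 ^+ 2 = 1 :> R by ring.
have r34 : row34_eq q t 1 0 x2 y2 <-> q * t * x2 = 2 - q * t.
  by rewrite row34_eq_inner // mul1r mul0r addr0.
rewrite /rows_eq; set u := _ * (_ * 1 + _); set v := _ * (_ * 0 + _).
have uv : q * t * x2 = 2 - q * t ->
    t * u = 1 - t /\ (t * v) ^+ 2 = q * t - 1.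
  move=> hx; have y2E : y2 ^+ 2 = 1 - x2 ^+ 2 by lra.
  split; first by rewrite /u; lra.
  have -> : (t * v) ^+ 2 = 4^-1 * ((q * t) ^+ 2 - (q * t * x2) ^+ 2).
    by rewrite /v !exprMn mulr0 add0r exprMn y2E; field.
  by rewrite hx; field.
split=> [[r0 r1 r2 /r34 hx] | [hx -> ->]]; have [hu hv] := uv hx.
  have u1 : 1 - q < u.
    rewrite -(ltr_pM2l t0) hu; nra.
  by have [] := rows012_rigid _ s0 _ h3 u1 _ r0 r1 r2; rewrite ?hv //; lra.
by have [] := rows_solution t0 ts hu hv; split=> //; apply/r34.
Qed.

(** Row 3 fixes Re (w_2 / w_1), leaving a sign for the imaginary part. One sign gives the stated
    w_2, the other violates row 0. *)
Lemma rows_eq_w1_special q s t x1 y1 x2 y2 x3 y3 (k := t + q - 2) :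
  4 <= q -> 0 < s -> q * s ^+ 2 = t -> 2 * q <= t ->
  k * t * x1 = t ^+ 2 - (q + 2) * t + 2 -> x1 ^+ 2 + y1 ^+ 2 = 1 ->
  [/\ x2 ^+ 2 + y2 ^+ 2 = 1, x3 ^+ 2 + y3 ^+ 2 = 1 &
      rows_eq q s t x1 y1 x2 y2 x3 y3] <->
  (q * (t - 1) * x2 = - ((q - 1) * t * x1 + k) /\
   q * (t - 1) * y2 = - ((q - 1) * t * y1)) /\ (x3 = 1 /\ y3 = 0).
Proof.
move=> q4 s0 ts qt; have t0 : 0 < t by lra.
have tN0 : t != 0 by rewrite gt_eqF.
move=> hx1 h1; rewrite /rows_eq.
set u := _ * (_ * x1 + _); set v := _ * (_ * y1 + _).
have k0 : 0 < k by rewrite /k; lra.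
have p0 : 0 < t - 1 by lra.
have q0 : 0 < q by lra.
have qpN0 : q * (t - 1) != 0 by rewrite mulf_neq0 // gt_eqF.
have ptN0 : 2 * (t - 1) != 0 by rewrite mulf_neq0 // gt_eqF.
(* For this x1 also k t (1 - x1) = 2 (q t - 1); the product of the two gives [ky1]. *)
have kx1 : k * t * (1 + x1) = 2 * (t - 1) ^+ 2.
  by rewrite mulrDr hx1 /k; ring.
have ky1 : (k * t * y1) ^+ 2 = 4 * (q * t - 1) * (t - 1) ^+ 2.
  rewrite exprMn; have -> : y1 ^+ 2 = 1 - x1 ^+ 2 by lra.
  by rewrite mulrBr mulr1 -exprMn hx1 /k; ring.
have uv : q * (t - 1) * x2 = - ((q - 1) * t * x1 + k) ->
    q * (t - 1) * y2 = - ((q - 1) * t * y1) ->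
    t * u = 1 - t /\ (t * v) ^+ 2 = q * t - 1.
  move=> hx hy.
  have eu : 2 * (t - 1) * (t * u) = - (k * t * (1 + x1)).
    rewrite [LHS](_ : _ = t * ((t - 1) * (q - 2) * x1 + q * (t - 1) * x2)).
      by rewrite hx /k; ring.
    by rewrite /u; field.
  have ev : 2 * (t - 1) * (t * v) = - (k * t * y1).
    rewrite [LHS](_ : _ = t * ((t - 1) * (q - 2) * y1 + q * (t - 1) * y2)).
      by rewrite hy /k; ring.
    by rewrite /v; field.
  split; first by apply: (mulfI ptN0); rewrite eu kx1; ring.
  apply: (mulfI (mulf_neq0 ptN0 ptN0)).
  by rewrite -expr2 -exprMn ev sqrrN ky1; ring.
split=> [[h2 h3 [r0 r1 r2]] | [[hx hy] [-> ->]]].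
  rewrite row34_eq_inner // => hr.
  (* r + i e = conj(w_1) w_2 = w_2 / w_1, as |w_1| = 1. *)
  set r := x1 * x2 + y1 * y2 in hr; pose e := x1 * y2 - x2 * y1.
  have x2E : x2 = r * x1 - e * y1.
    by rewrite -[LHS]mulr1 -h1 /r /e; ring.
  have y2E : y2 = r * y1 + e * x1.
    by rewrite -[LHS]mulr1 -h1 /r /e; ring.
  have re1 : r ^+ 2 + e ^+ 2 = 1.
    have -> : r ^+ 2 + e ^+ 2 = (x1 ^+ 2 + y1 ^+ 2) * (x2 ^+ 2 + y2 ^+ 2).
      by rewrite /r /e; ring.
    by rewrite h1 h2 mulr1.
  have tky2 : k * t * y1 ^+ 2 = k * t - (k * t * x1) * x1.
    have -> : y1 ^+ 2 = 1 - x1 ^+ 2 by lra.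
    ring.
  (* From q t r = 2 - q t one gets (q t e)^2 = 4 (q t - 1), which matches [ky1] after scaling by (t
     - 1)^2. *)
  have /eqP : (q * (t - 1) * (t * e)) ^+ 2 = (t * (k * y1)) ^+ 2.
    rewrite [RHS](_ : _ = (k * t * y1) ^+ 2); last by ring.
    have -> : (q * (t - 1) * (t * e)) ^+ 2 =
       (t - 1) ^+ 2 * ((q * t) ^+ 2 * e ^+ 2) by ring.
    have -> : e ^+ 2 = 1 - r ^+ 2 by lra.
    by rewrite mulrBr -exprMn hr ky1; ring.
  rewrite eqf_sqr => /orP[]/eqP he.
    have hx : q * (t - 1) * x2 = - ((q - 1) * t * x1 + k).
      apply: (mulfI tN0); rewrite x2E.
      have -> : t * (q * (t - 1) * (r * x1 - e * y1)) =
         (t - 1) * (q * t * r) * x1 - (q * (t - 1) * (t * e)) * y1 by ring.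
      rewrite hr he.
      have -> : t * (k * y1) * y1 = k * t * y1 ^+ 2 by ring.
      by rewrite tky2 hx1; ring.
    have hy : q * (t - 1) * y2 = - ((q - 1) * t * y1).
      apply: (mulfI tN0); rewrite y2E.
      have -> : t * (q * (t - 1) * (r * y1 + e * x1)) =
         (t - 1) * (q * t * r) * y1 + (q * (t - 1) * (t * e)) * x1 by ring.
      rewrite hr he.
      have -> : t * (k * y1) * x1 = (k * t * x1) * y1 by ring.
      by rewrite hx1; ring.
    have [hu hv] := uv hx hy.
    have u1 : 1 - q < u by rewrite -(ltr_pM2l t0) hu; nra.
    by have [] := rows012_rigid _ s0 _ h3 u1 _ r0 r1 r2; rewrite ?hv //; lra.
  (* The other solution of row 3, w_2' = w_1^2 / w_2: there |t v| exceeds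
     sqrt (q t - 1) by the factor 1 + 2 x1. *)
  exfalso.
  have x1_gt0 : 0 < x1.
    have kt0 : 0 < k * t by apply: mulr_gt0.
    by rewrite -(pmulr_rgt0 _ kt0) hx1; nra.
  have u1 : 1 - q < u.
    have x2ge : -1 <= x2 by clear -h2; have := sqr_ge0 y2; nra.
    rewrite /u; nra.
  have hv : (t * v) ^+ 2 = (q * t - 1) * (1 + 2 * x1) ^+ 2.
    have ev : 2 * (t - 1) * (t * v) = - (k * t * y1 * (1 + 2 * x1)).
      rewrite [LHS](_ : _ = t * (t - 1) * (q - 2) * y1 + t * (q * (t - 1) * y2)).
        rewrite y2E.
        have -> : t * (q * (t - 1) * (r * y1 + e * x1)) =
          (t - 1) * (q * t * r) * y1 + (q * (t - 1) * (t * e)) * x1 by ring.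
        rewrite hr he.
        have -> : k * t * y1 * (1 + 2 * x1) =
           y1 * (k * t * (1 + x1)) + k * t * y1 * x1 by ring.
        by rewrite kx1; ring.
      by rewrite /v; field.
    apply: (mulfI (mulf_neq0 ptN0 ptN0)).
    by rewrite -expr2 -exprMn ev sqrrN exprMn ky1; ring.
  have n0 : 0 < q * t - 1 by nra.
  have big : q * t - 1 < (t * v) ^+ 2.
    by rewrite hv ltr_pMr // exprn_egt1 //; lra.
  have [||_ _ ?] := rows012_rigid _ s0 _ h3 u1 (ltW big) r0 r1 r2; lra.
have [hu hv] := uv hx hy.
have [r0 r1 r2] := rows_solution t0 ts hu hv.
(* |w_2| = 1 must come from the formula: |(q - 1) t w_1 + k| = q (t - 1). *)
have h2 : x2 ^+ 2 + y2 ^+ 2 = 1.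
  apply: (mulfI (mulf_neq0 qpN0 qpN0)); rewrite -expr2 mulrDr -!exprMn hx hy.
  rewrite [LHS](_ : _ = ((q - 1) * t) ^+ 2 * (x1 ^+ 2 + y1 ^+ 2) + k ^+ 2
     + 2 * (q - 1) * (k * t * x1)); last by ring.
  by rewrite h1 hx1 /k; ring.
split=> //; first by ring.
split=> //; rewrite row34_eq_inner //.
apply: (mulfI (lt0r_neq0 p0)).
rewrite [LHS](_ : _ = t * (x1 * (q * (t - 1) * x2) + y1 * (q * (t - 1) * y2))).
  rewrite hx hy.
  rewrite [LHS](_ : _ = - ((q - 1) * t ^+ 2 * (x1 ^+ 2 + y1 ^+ 2) + k * t * x1)).
    by rewrite h1 hx1; ring.
  by ring.
by ring.
Qed.

End RealSystem.

(** * The given eigenmatrix and its eigenvalues *)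

Section EigenmatrixRows.
Variables (R : realType) (q m : nat).
Hypothesis m2 : (2 <= m)%N.

(** Writing every power through z and s removes the truncated exponents, so that [ring] and [field]
    apply; it is used over both R and R[i]. *)
Lemma expr_predm (A : comNzRingType) (z : A) (s := z ^+ (m - 1)) :
  [/\ z ^+ (2 * m - 1) = z * s ^+ 2, z ^+ (2 * m) = z ^+ 2 * s ^+ 2,
      z ^+ (2 * m - 2) = s ^+ 2, z ^+ m = z * s &
      z ^+ (4 * m - 2) = z ^+ 2 * s ^+ 4].
Proof.
by split; rewrite /s -?exprM -?exprD -?exprS; congr (_ ^+ _); lia.
Qed.

Let qr : R := q%:R.
Let s : R := qr ^+ (m - 1).
Let t : R := qr ^+ (2 * m - 1).

(* Real or imaginary parts of the eigenvalues, given those of w_1, w_2, w_3 and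
   of w_0 = w_4. *)
Definition eigen_parts (x1 x2 x3 x4 : R) : seq R :=
  let u := 2^-1 * ((qr - 2) * x1 + qr * x2) in
  [:: x4 * (qr - 1) + t * u + (t - qr) * x3;
      (qr - 1) * (x4 - x3) + s * (u - (qr - 1) * x3);
      (qr - 1) * (x4 - x3) - s * (u - (qr - 1) * x3);
      2^-1 * qr * s * (x1 - x2);
      - (2^-1 * qr * s * (x1 - x2))].

(* Stated for an arbitrary I, so that I := 'i and I := - 'i give an eigenvalue
   and its conjugate. *)
Lemma scheme_P_row (I : R[i]) (x1 y1 x2 y2 x3 y3 : R) (i : 'I_5) :
  \sum_(j < 5) scheme_P R false q m i j *
    nth 0 [:: 1; x1%:C + I * y1%:C; x2%:C + I * y2%:C; x3%:C + I * y3%:C; 1] j =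
  (nth 0 (eigen_parts x1 x2 x3 1) i)%:C +
  I * (nth 0 (eigen_parts y1 y2 y3 0) i)%:C.
Proof.
rewrite /eigen_parts /t !big_ord_recl big_ord0 !mxE.
have [e1 _ _ _ _] := expr_predm qr.
have [f1 f2 f3 f4 _] := expr_predm (q%:R : R[i]).
have f5 : q%:R ^+ (m - 1) = s%:C by rewrite /s rmorphXn /= rmorph_nat.
have f6 : q%:R = qr%:C by rewrite rmorph_nat.
case: i => [[|[|[|[|[|//]]]]] ?] /=;
  rewrite ?e1 -/s ?(f1, f2, f3, f4) f5 ?f6; by field.
Qed.

Lemma scheme_tE : qr * s ^+ 2 = t.
Proof. by rewrite /t; have [->] := expr_predm qr. Qed.

Hypothesis q4 : (4 <= q)%N.

Lemma scheme_q_ge4 : 4 <= qr.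
Proof. by rewrite ler_nat. Qed.

Lemma scheme_s_ge4 : 4 <= s.
Proof.
have := scheme_q_ge4 => qr4; rewrite /s; have -> : (m - 1)%N = (m - 2).+1 by lia.
have : 1 <= qr ^+ (m - 2) by apply: exprn_ege1; lra.
by rewrite exprS; nra.
Qed.

Lemma scheme_t_ge : 2 * qr <= t.
Proof.
have := scheme_q_ge4; have := scheme_s_ge4 => s4 qr4.
by rewrite -scheme_tE mulrC ler_pM2l; nra.
Qed.

Variables (X : finType) (S : symmetric_scheme R X 4).

Lemma scheme_P_printed : ~ first_eigenmatrix S (scheme_P R true q m).
Proof.
move=> hP; have := first_eigenmatrix_row_sum hP (inord 2).
rewrite -val_eqE /= inordK //= !big_ord_recl big_ord0 !mxE /= !inordK //=.
have [_ _ _ f4 _] := expr_predm (q%:R : R[i]).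
have f5 : q%:R ^+ (m - 1) = s%:C by rewrite /s rmorphXn /= rmorph_nat.
have f6 : q%:R = qr%:C by rewrite rmorph_nat.
rewrite f4 f5 f6 [X in X = _ -> _](_ : _ = (- (2 * (qr - 1) * (s - 1)))%:C).
  by case; have := scheme_q_ge4; have := scheme_s_ge4; nra.
by field.
Qed.

Hypothesis hP : first_eigenmatrix S (scheme_P R false q m).

Lemma scheme_card : #|X|%:R = (qr * t - 1)%:C.
Proof.
have := first_eigenmatrix_row_sum hP ord0; rewrite eqxx => <-.
(* With I = 0 and all weights 1 the eigenvalue of row 0 is the plain row sum. *)
have := scheme_P_row 0 1 0 1 0 1 0 ord0.
rewrite !big_ord_recl !big_ord0 /= !mul0r !addr0 !mulr1 => ->.
by congr _%:C; field.
Qed.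

(** This P is real, so the two factors in [complex_hadamard_eigen] are conjugate and their product
    is the sum of squares of the two [eigen_parts]. *)
Lemma complex_hadamard_rows (w1 w2 w3 : R[i]) :
  complex_hadamard
    (\sum_(j < 5) nth 0 [:: 1; w1; w2; w3; 1] j *: adj_mx S j) <->
  [/\ complex.Re w1 ^+ 2 + complex.Im w1 ^+ 2 = 1,
      complex.Re w2 ^+ 2 + complex.Im w2 ^+ 2 = 1,
      complex.Re w3 ^+ 2 + complex.Im w3 ^+ 2 = 1 &
      rows_eq qr s t (complex.Re w1) (complex.Im w1)
        (complex.Re w2) (complex.Im w2) (complex.Re w3) (complex.Im w3)].
Proof.
rewrite (complex_hadamard_eigen hP).
set x1 := complex.Re w1; set y1 := complex.Im w1.
set x2 := complex.Re w2; set y2 := complex.Im w2.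
set x3 := complex.Re w3; set y3 := complex.Im w3.
pose a i := nth 0 (eigen_parts x1 x2 x3 1) i.
pose b i := nth 0 (eigen_parts y1 y2 y3 0) i.
have eigE (i : 'I_5) :
    (\sum_j scheme_P R false q m i j * nth 0 [:: 1; w1; w2; w3; 1] j) *
    (\sum_j scheme_P R false q m i j * (nth 0 [:: 1; w1; w2; w3; 1] j)^*) =
    (a i ^+ 2 + b i ^+ 2)%:C.
  have -> : \sum_j scheme_P R false q m i j * nth 0 [:: 1; w1; w2; w3; 1] j =
      (a i)%:C + 'i * (b i)%:C.
    by rewrite -scheme_P_row -!complexE.
  have -> : \sum_j scheme_P R false q m i j *
      (nth 0 [:: 1; w1; w2; w3; 1] j)^* = (a i)%:C + (- 'i) * (b i)%:C.
    have cE z : z^* = (complex.Re z)%:C + (- 'i) * (complex.Im z)%:C.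
      by case: z => x y; simpc.
    rewrite -scheme_P_row -!cE; apply: eq_bigr => -[[|[|[|[|[|//]]]]] ?] _ //=.
      by rewrite rmorph1.
    by rewrite rmorph1.
  rewrite rmorphD !rmorphXn /=.
  rewrite [LHS](_ : _ = (a i)%:C ^+ 2 - 'i ^+ 2 * (b i)%:C ^+ 2).
    by rewrite sqr_i; ring.
  by ring.
have normE : (forall j : 'I_5, `|nth 0 [:: 1; w1; w2; w3; 1] j| = 1) <->
    [/\ `|w1| = 1, `|w2| = 1 & `|w3| = 1].
  split=> [h | [h1 h2 h3] [[|[|[|[|[|//]]]]] ?]]; rewrite /= ?normr1 //.
  by split; [have := h (inord 1) | have := h (inord 2) | have := h (inord 3)];
    rewrite inordK.
have rowE (i : 'I_5) :
    (\sum_j scheme_P R false q m i j * nth 0 [:: 1; w1; w2; w3; 1] j) *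
    (\sum_j scheme_P R false q m i j * (nth 0 [:: 1; w1; w2; w3; 1] j)^*) =
      #|X|%:R <-> a i ^+ 2 + b i ^+ 2 = qr * t - 1.
  by rewrite eigE scheme_card; split=> [/complexI|->].
rewrite normE.
split=> [[[/normc_eq1P h1 /normc_eq1P h2 /normc_eq1P h3] h] |
         [/normc_eq1P h1 /normc_eq1P h2 /normc_eq1P h3 [r0 r1 r2 r3]]].
  have {}h i : (i < 5)%N -> a i ^+ 2 + b i ^+ 2 = qr * t - 1.
    by move=> i5; apply/(rowE (Ordinal i5)); exact: h.
  split=> //; split.
  - by rewrite /row0_eq -(h 0%N) // /a /b /=; ring.
  - by rewrite /row12_eq -(h 1%N) // /a /b /=; ring.
  - by rewrite /row12_eq -(h 2%N) // /a /b /=; ring.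
  - by rewrite /row34_eq -(h 3%N) // /a /b /= -scheme_tE; field.
split=> // i; apply/rowE.
case: i => [[|[|[|[|[|//]]]]] ?]; rewrite /a /b /=.
- by rewrite -[RHS]r0; ring.
- by rewrite -[RHS]r1; ring.
- by rewrite -[RHS]r2; ring.
- by rewrite -[RHS]r3 -scheme_tE; field.
- by rewrite -[RHS]r3 -scheme_tE; field.
Qed.

End EigenmatrixRows.

(** * Translation between the complex conditions on the weights and the real system *)

Theorem theorem1 (R : realType) (q m : nat) (hq : (4 <= q)%N) (hm : (2 <= m)%N)
    (X : finType) (S : symmetric_scheme R X 4) (as_printed : bool)
    (hP : first_eigenmatrix S (scheme_P R as_printed q m))
    (w0 w1 w2 w3 w4 : R[i])
    (hw0 : w0 = 1) (hw1 : w1 != 0) (hw2 : w2 != 0) (hw3 : w3 != 0)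
    (hw4 : w4 != 0) (hw4_1 : w4 = 1) :
  let Q : R[i] := q%:R in
  let W := \sum_(j < 5) nth 0 [:: w0; w1; w2; w3; w4] j *: adj_mx S j in
  let a01 := w0 / w1 + w1 / w0 in
  (w1 = 1 ->
     (complex_hadamard W <->
      w2 ^+ 2 + 2 * (Q ^+ (2 * m) - 2) / Q ^+ (2 * m) * w2 + 1 = 0 /\
      w3 = 1)) /\
  (a01 = 2 * (Q ^+ (4 * m - 2) - (Q + 2) * Q ^+ (2 * m - 1) + 2) /
         ((Q ^+ (2 * m - 1) + Q - 2) * Q ^+ (2 * m - 1)) ->
     (complex_hadamard W <->
      w2 = - (((Q - 1) * Q ^+ (2 * m - 1) * w1 + Q ^+ (2 * m - 1) + Q - 2) /
              ((Q ^+ (2 * m - 1) - 1) * Q)) /\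
      w3 = 1)).
Proof.
move=> Q W a01; rewrite {}/W {}/a01; subst w0 w4.
case: as_printed hP => hP; first by case: (scheme_P_printed hm hq hP).
rewrite (complex_hadamard_rows hm hP) {hw2 hw3 hw4 hP}.
have := scheme_tE R q hm; have := scheme_q_ge4 R hq.
have := scheme_s_ge4 R hm hq; have := scheme_t_ge R hm hq.
have QE : Q = (q%:R : R)%:C by rewrite rmorph_nat.
have [f1 f2 _ _ f5] := expr_predm hm (q%:R : R).
have QX e : Q ^+ e = ((q%:R : R) ^+ e)%:C by rewrite QE rmorphXn.
rewrite !QX QE f2 f5.
set s := (q%:R : R) ^+ (m - 1); set t := (q%:R : R) ^+ (2 * m - 1).
set qr := (q%:R : R) => t2 s4 qr4 tE.
have s0 : 0 < s by lra.
have t0 : 0 < t by lra.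
have qt0 : 0 < qr * t by apply: mulr_gt0; lra.
have w3P : w3 = 1 <-> complex.Re w3 = 1 /\ complex.Im w3 = 0.
  by case: w3 => x y /=; split=> [[]|[-> ->]].
have e4 : qr ^+ 2 * s ^+ 4 = t ^+ 2 by rewrite -tE; ring.
have e2 : qr ^+ 2 * s ^+ 2 = qr * t by rewrite -tE; ring.
rewrite e2 e4; split=> [-> /= | ].
  rewrite w3P.
  (* a is the sum of the roots of the quadratic for w_2, that is 2 Re w_2. *)
  pose a := - (2 * (qr * t - 2) / (qr * t)).
  have aqt : qr * t * a = - (2 * (qr * t - 2)).
    by rewrite /a mulrN [X in - X]mulrC divfK // gt_eqF.
  have a4 : a ^+ 2 < 4.
    rewrite -(ltr_pM2l (exprn_gt0 2 qt0)) -exprMn aqt; nra.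
  have -> : w2 ^+ 2 + 2 * ((qr * t)%:C - 2) / (qr * t)%:C * w2 + 1 =
      w2 ^+ 2 - a%:C * w2 + 1.
    by rewrite /a rmorphN mulNr opprK !(rmorphM, fmorphV, rmorphB, rmorph_nat).
  rewrite (reciprocal_rootP _ a4).
  have aP x : 2 * x = a <-> qr * t * x = 2 - qr * t.
    split=> h; first by have : qr * t * (2 * x) = qr * t * a by [rewrite h]; lra.
    apply: (mulfI (lt0r_neq0 qt0)); rewrite aqt; lra.
  split=> [[_ h2 h3] | [[/aP hx h2] [x3 y3]]].
    by move/(rows_eq_w1_eq1 qr4 s0 tE t2 h2 h3) => [/aP ? -> ->].
  have h3 : complex.Re w3 ^+ 2 + complex.Im w3 ^+ 2 = 1 by rewrite x3 y3; ring.
  split=> //; first by ring.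
  by apply/(rows_eq_w1_eq1 qr4 s0 tE t2 h2 h3).
pose k := t + qr - 2.
have k0 : 0 < k by rewrite /k; lra.
have kt0 : 0 < k * t by apply: mulr_gt0.
pose a := 2 * (t ^+ 2 - (qr + 2) * t + 2) / (k * t).
have akt : k * t * a = 2 * (t ^+ 2 - (qr + 2) * t + 2).
  by rewrite /a [LHS]mulrC divfK // gt_eqF.
(* k t (a + 2) = 4 (t - 1)^2 and k t (2 - a) = 4 (q t - 1) are both positive. *)
have a4 : a ^+ 2 < 4.
  have am : 0 < a + 2.
    rewrite -(pmulr_rgt0 _ kt0) mulrDr akt /k; nra.
  have ap : 0 < 2 - a.
    rewrite -(pmulr_rgt0 _ kt0) mulrBr akt /k; nra.
  nra.
have -> : 2 * ((t ^+ 2)%:C - (qr%:C + 2) * t%:C + 2) /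
    ((t%:C + qr%:C - 2) * t%:C) = a%:C.
  by rewrite /a /k !(rmorphM, fmorphV, rmorphB, rmorphD, rmorph_nat).
(* The hypothesis reads w_1 + 1 / w_1 = a with |a| < 2, so |w_1| = 1 follows from it. *)
move=> a01; have /(reciprocal_rootP _ a4)[x1E h1] : w1 ^+ 2 - a%:C * w1 + 1 = 0.
  by rewrite -a01; field.
have kx1 : k * t * complex.Re w1 = t ^+ 2 - (qr + 2) * t + 2.
  by rewrite -x1E in akt; lra.
have w2P : w2 = - (((qr%:C - 1) * t%:C * w1 + t%:C + qr%:C - 2) /
      ((t%:C - 1) * qr%:C)) <->
    qr * (t - 1) * complex.Re w2 = - ((qr - 1) * t * complex.Re w1 + k) /\
    qr * (t - 1) * complex.Im w2 = - ((qr - 1) * t * complex.Im w1).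
  have -> : (t%:C - 1) * qr%:C = (qr * (t - 1))%:C :> R[i] by ring.
  have -> : (qr%:C - 1) * t%:C * w1 + t%:C + qr%:C - 2 =
     ((qr - 1) * t)%:C * w1 + k%:C by rewrite /k; ring.
  have D0 : (qr * (t - 1))%:C != 0 :> R[i].
    rewrite (inj_eq (@complexI R) _ 0) gt_eqF // mulr_gt0 //; lra.
  have -> (z : R[i]) : w2 = - (z / (qr * (t - 1))%:C) <->
      (qr * (t - 1))%:C * w2 = - z.
    split=> [->|h]; first by rewrite mulrN [X in - X]mulrC divfK.
    by rewrite -mulNr -h mulrAC divff // mul1r.
  case: w1 {hw1 a01 x1E h1 kx1} => x1 y1; case: w2 => x2 y2; simpc.
  by split=> [[-> ->]|/= [-> ->]].
rewrite w2P w3P.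
rewrite -(rows_eq_w1_special _ _ _ _ qr4 s0 tE t2 kx1 h1).
by split=> [[_ ? ? ?]|[]].
Qed.
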